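(* Fix an integer $q \geq 3$. For positive integers $f, m$ with $(q-1)m < f < qm$, let $N(f,m)$ denote the number of numerical semigroups with multiplicity $m$ and Frobenius number $f$, and put $\alpha := f/m - (q-1) \in (0,1)$. Then, as $(f,m)$ varies subject to $(q-1)m < f < qm$, \[N(f,m) = \left(c_q^{\alpha}\, c_{q-1}^{1-\alpha}\right)^{m + o(m)},\] where $o(m)$ denotes a quantity $E(f,m)$ with $E(f,m)/m \to 0$ as $m \to \infty$ (uniformly over the admissible $f$).
   Context: A numerical semigroup is a subset $\Lambda \subseteq \mathbb{N}_0$ containing $0$, closed under addition, with finite complement. Its multiplicity is $m(\Lambda) = \min(\Lambda \setminus \{0\})$, its conductor $c(\Lambda)$ is the least $c \in \mathbb{N}_0$ with $c + \mathbb{N}_0 \subseteq \Lambda$, and its Frobenius number is $f(\Lambda) = c(\Lambda) - 1$. For $q \geq 1$, $c_q := \sqrt{\lfloor (q+2)^2/4 \rfloor}$. *)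

(* Defs.v *)
From Stdlib Require Import Reals.
From mathcomp Require Import all_boot.
From mathcomp Require Import boolp.

Set Implicit Arguments.
Unset Strict Implicit.
Unset Printing Implicit Defensive.

Definition is_numerical_semigroup (L : nat -> Prop) : Prop :=
  L 0%N /\ (forall x y, L x -> L y -> L (x + y)%N) /\
  exists c, forall n, (c <= n)%N -> L n.

Definition has_multiplicity (L : nat -> Prop) (m : nat) : Prop :=
  (0 < m)%N /\ L m /\ forall k, (0 < k)%N -> (k < m)%N -> ~ L k.

Definition has_conductor (L : nat -> Prop) (c : nat) : Prop :=
  (forall n, (c <= n)%N -> L n) /\
  forall c', (forall n, (c' <= n)%N -> L n) -> (c <= c')%N.

(* f(L) = c(L) - 1; here only needed for f a natural number. *)
Definition has_frobenius (L : nat -> Prop) (f : nat) : Prop :=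
  has_conductor L f.+1.

Definition ext_set (f : nat) (S : {set 'I_f.+1}) : nat -> Prop :=
  fun x => if (x <= f)%N then (inord x : 'I_f.+1) \in S else true.

(* N(f,m): number of numerical semigroups with multiplicity m and Frobenius
   number f.  Such a semigroup contains every integer > f, hence is uniquely
   determined by its intersection with {0,...,f}; we count these traces. *)
Definition N_count (f m : nat) : nat :=
  #|[set S : {set 'I_f.+1} |
      `[< is_numerical_semigroup (ext_set S) /\
          has_multiplicity (ext_set S) m /\
          has_frobenius (ext_set S) f >] ]|.

Definition c_ (q : nat) : R := sqrt (INR (((q + 2) ^ 2) %/ 4)%N).

Definition alpha (q f m : nat) : R := Rminus (Rdiv (INR f) (INR m)) (Rminus (INR q) R1).

(* Main.v *)
Require Import Defs.
From Stdlib Require Import Reals Lra.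
From mathcomp Require Import all_boot zify.
From mathcomp Require Import boolp.

(** Write f = (q - 1) m + r.  A semigroup of multiplicity m is encoded by its
    Kunz word k, where k_i m + i is its least element congruent to i mod m; the
    conditions on k are k_i + k_j >= k_(i+j) and, when i + j wraps around m,
    k_i + k_j + 1 >= k_(i+j-m).  Here k_r = q, k_i <= q, and k_i < q for i > r.

    Lower bound: a box of words with all entries at least about q/2 satisfies
    every condition, and the product of its sides over a pair {i, r - i mod m}
    is floor((q+2)^2/4) if i <= r and floor((q+1)^2/4) if i > r.

    Upper bound: fix a large D, let p be the largest value such that at least D
    entries are >= p, and let S be the D largest positions of such entries.
    Every s in S forces k_i + k_(s-i) >= p (or p - 1, if i > s).  A small set F of
    positions, chosen greedily, already forces through these inequalities almost
    everything that the whole word forces.  Among the words with given S, F and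
    values on F, let lo_i be the least value of k_i: then
    lo_i + lo_(s-i) >= p (or p - 1) for most pairs (i, s), so some s in S is good
    for almost all i, and pairing i with s - i bounds the number of these words
    by the product of the sides of the box above, up to a factor exp(o(m)). *)

Set Implicit Arguments.
Unset Strict Implicit.
Unset Printing Implicit Defensive.

(* [zify] binds the key [R] to [ring_scope]. *)
Delimit Scope R_scope with Re.

(** * Quarter squares, which are the squares of [c_ p], and reflections of positions *)

Definition quarter_sq (p : nat) : nat := ((p + 2) ^ 2) %/ 4.

(** The lower bound on [k i + k (refl s i)] that follows from [p <= k s]; one is lost when [i > s],
    since the sum of the two positions then wraps around [m]. *)
Definition level (p s i : nat) : nat := if i <= s then p else p.-1.

Lemma quarter_sq_gt0 p : 0 < quarter_sq p.
Proof. by rewrite divn_gt0 // -mulnn; nia. Qed.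

Lemma leq_quarter_sq p p' : p <= p' -> quarter_sq p <= quarter_sq p'.
Proof. by move=> le_pp'; apply: leq_div2r; rewrite leq_exp2r // leq_add2r. Qed.

Lemma leq_mul_quarter_sq x y p : x + y <= p + 2 -> x * y <= quarter_sq p.
Proof.
move=> le_xy; rewrite leq_divRL // -mulnn.
have := (nat_Cauchy x y).1; rewrite -!mulnn; nia.
Qed.

Section Reflection.
Variable m : nat.
Implicit Types s i : 'I_m.

Lemma refl_subproof s i : (if i <= s then s - i else m + s - i) < m.
Proof. by have := ltn_ord s; have := ltn_ord i; case: ifP; lia. Qed.

Definition refl s i : 'I_m := Ordinal (refl_subproof s i).

Lemma val_refl s i : refl s i = (if i <= s then s - i else m + s - i) :> nat.
Proof. by []. Qed.

(** A position and its reflection are on the same side of [s], so the two have the same level. *)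
Lemma refl_leE s i : (refl s i <= s) = (i <= s).
Proof.
by rewrite val_refl; have := ltn_ord i; case: (leqP i s); lia.
Qed.

Lemma reflK s : involutive (refl s).
Proof.
move=> i; apply: ord_inj; rewrite val_refl refl_leE val_refl.
by have := ltn_ord i; have := ltn_ord s; case: (leqP i s); lia.
Qed.

Lemma refl_injl i : injective (refl^~ i).
Proof.
move=> s s' /(congr1 val) /= e; apply: ord_inj; move: e.
have := ltn_ord i; have := ltn_ord s; have := ltn_ord s'.
by do 2 case: ifP; lia.
Qed.

End Reflection.

(** * Kunz words, their fingerprints, and the size of one fibre *)

Section Kunz.
Variables (q m : nat).
Local Notation word := {ffun 'I_m -> 'I_q.+1}.
Implicit Types (k : word) (S F : {set 'I_m}) (i j s : 'I_m).

Definition kunz k : Prop := forall i j (l : 'I_m),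
  (i + j = l -> k l <= k i + k j) /\ (i + j = m + l -> k l <= k i + k j + 1).

(** The positions [i] and [refl s i] add up to [s] or to [m + s], so this is the Kunz inequality
    with target [s]. *)
Lemma kunz_refl k p s i : kunz k -> p <= k s ->
  level p s i - k i <= k (refl s i).
Proof.
move=> /(_ i (refl s i) s) [h1 h2] ps; move: h1 h2; rewrite /level val_refl.
have := ltn_ord i; case: (leqP i s) => le_is lt_im h1 h2.
  by have := h1 (subnKC le_is); lia.
have e : i + (m + s - i) = m + s by lia.
by have := h2 e; lia.
Qed.

(** The best lower bound on [k j] deducible from the values on [F] alone, if every entry on [S] is
    at least [p]; it is 0 when nothing can be deduced. *)
Definition forced p S F k j : nat :=
  \max_(i in F) \max_(s in S | refl s i == j) (level p s i - k i).

Lemma leq_forced p S F k i s : i \in F -> s \in S ->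
  level p s i - k i <= forced p S F k (refl s i).
Proof.
move=> iF sS; apply: leq_trans (leq_bigmax_cond _ iF).
by apply: (@leq_bigmax_cond _ (fun s' => (s' \in S) && (refl s' i == refl s i))
  (fun s' => level p s' i - k i)); rewrite sS eqxx.
Qed.

Lemma forced_le p S F k j n :
  (forall i s, i \in F -> s \in S -> refl s i = j -> level p s i - k i <= n) ->
  forced p S F k j <= n.
Proof.
by move=> h; apply/bigmax_leqP => i iF; apply/bigmax_leqP => s /andP[sS /eqP e]; apply: h.
Qed.

Lemma forced_le_val p S F k j : kunz k -> (forall s, s \in S -> p <= k s) ->
  forced p S F k j <= k j.
Proof.
by move=> kk pS; apply: forced_le => i s iF sS <-; apply: kunz_refl (pS _ sS).
Qed.

Lemma forced_subset p S F F' k j : F \subset F' ->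
  forced p S F k j <= forced p S F' k j.
Proof.
move=> /subsetP sub; apply: forced_le => i s iF sS <-.
exact: leq_forced (sub _ iF) sS.
Qed.

Lemma eq_forced p S F k k' j : {in F, k =1 k'} ->
  forced p S F k j = forced p S F k' j.
Proof. by move=> e; apply: eq_bigr => i iF; rewrite e. Qed.

Definition unforced p S F k i : {set 'I_m} :=
  [set s in S | forced p S F k (refl s i) < level p s i - k i].

(* The set [F] is optimal for the trade-off between the total of the forced
   lower bounds and [t] times the size of [F]: a vertex with more than [t]
   unforced neighbours could profitably be added to it. *)
Lemma exists_fingerprint_set p S k t : p <= q ->
  exists F, t * #|F| <= m * q /\ forall i, #|unforced p S F k i| <= t.
Proof.
move=> pq.
(* Counting the complement turns the penalty [t * #|F|] into a reward and keeps [V] free of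
   subtraction. *)
pose V F := \sum_j forced p S F k j + t * #|~: F|.
pose F := [arg max_(F > (set0 : {set 'I_m})) V F].
have maxF F' : V F' <= V F.
  by rewrite /F; case: arg_maxnP => // F0 _ /(_ F' isT).
exists F; split.
  have sumF : \sum_j forced p S F k j <= m * q.
    have <- : \sum_(j < m) q = m * q by rewrite sum_nat_const card_ord.
    apply: leq_sum => j _.
    apply: forced_le => i s _ _ _; apply: leq_trans (leq_subr _ _) _.
    by apply: leq_trans pq; rewrite /level; case: ifP => _ //; apply: leq_pred.
  have := leq_trans (leq_addl _ _) (maxF set0); rewrite setC0 cardsT card_ord /V.
  have := cardsC F; rewrite card_ord; nia.
move=> i; rewrite leqNgt; apply/negP => lt_t.
have iF : i \notin F.
  apply/negP => iF; move: lt_t; rewrite (_ : unforced _ _ _ _ _ = set0) ?cards0 //.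
  apply/setP => s; rewrite !inE; apply/negP => /andP[sS].
  by rewrite ltnNge leq_forced.
have := maxF (i |: F); apply/negP; rewrite -ltnNge /V.
have cardF : #|~: F| = #|~: (i |: F)|.+1.
  have := cardsC F; have := cardsC (i |: F); rewrite cardsU1 iF.
  move: #|F| #|~: F| #|~: (i |: F)| => x y z; rewrite !card_ord add1n => *; lia.
suff : \sum_j forced p S F k j + #|unforced p S F k i|
       <= \sum_j forced p S (i |: F) k j by rewrite cardF mulnS; move: (t * _) lt_t; lia.
(* Distinct unforced [s] reach distinct positions [refl s i], and at each of these adding [i] raises
   the forced bound by at least 1. *)
rewrite -(card_imset _ (@refl_injl m i)) -sum1_card [X in _ + X]big_mkcond -big_split /=.
apply: leq_sum => j _; case: imsetP => [[s]|_]; last first.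
  by rewrite addn0 forced_subset // subsetUr.
rewrite inE => /andP[sS lt_s] ->; rewrite addn1; apply: leq_trans lt_s _.
by rewrite leq_forced // !inE eqxx.
Qed.

(** [fp_le] and [fp_lt] together say that outside [F] the word is at most [level p s i] for every
    [s] in [S]: the value that caps an entry is also the lower bound for the sum over a reflected
    pair. *)
Record fingerprint (D B t : nat) p S F k : Prop := Fingerprint {
  fp_p : p <= q;
  fp_S : #|S| = D;
  fp_F : #|F| <= B;
  fp_sub : S \subset F;
  fp_ge : forall s, s \in S -> p <= k s;
  fp_le : forall i, i \notin F -> k i <= p;
  fp_lt : forall i s, i \notin F -> s \in S -> s < i -> k i < p;
  fp_unforced : forall i, #|unforced p S F k i| <= t }.

(** The largest remaining element of [T] is added [D] times. *)
Lemma exists_top_subset (T : {set 'I_m}) D : D <= #|T| ->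
  exists S, [/\ S \subset T, #|S| = D &
    forall i s, i \in T -> s \in S -> s < i -> i \in S].
Proof.
elim: D => [_|D IH ltD]; first by exists set0; rewrite sub0set cards0; split=> // ? ?; rewrite !inE.
have [S [sST cS top]] := IH (ltnW ltD).
have /card_gt0P [x0 x0T] : 0 < #|T :\: S| by rewrite cardsD (setIidPr sST) cS; lia.
pose x := [arg max_(x > x0 in T :\: S) (x : nat)].
have [xT xmax] : x \in T :\: S /\ forall y, y \in T :\: S -> y <= x.
  by rewrite /x; case: arg_maxnP.
move: (xT); rewrite inE => /andP[xS xT'].
exists (x |: S); split; first by rewrite subUset sub1set xT'.
  by rewrite cardsU1 xS cS.
move=> i s iT; rewrite !inE => /orP[/eqP -> | sS] lt_si; apply/orP; right; last exact: top lt_si.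
by apply/negPn/negP => iS; have := xmax i; rewrite inE iT iS => /(_ isT); lia.
Qed.

Lemma exists_fingerprint k D t : 0 < D -> D <= m -> 0 < t ->
  exists p S F, fingerprint D ((m * q) %/ t + 2 * D) t p S F k.
Proof.
move=> D0 Dm t0; pose T p := [set i | p <= k i].
have exT : exists p, D <= #|T p|.
  by exists 0; rewrite (_ : T 0 = setT) ?cardsT ?card_ord //; apply/setP=> i; rewrite !inE.
have leT p : D <= #|T p| -> p <= q.
  move=> h; have /card_gt0P [i] := leq_trans D0 h; rewrite inE => /leq_trans; apply.
  by rewrite -ltnS ltn_ord.
case: (ex_maxnP exT leT) => p Tp maxp.
have [S [sST cS top]] := exists_top_subset Tp.
have [F [tF unF]] := exists_fingerprint_set S k t (leT p Tp).
(* Maximality of [p] leaves fewer than [D] entries above [p], so adding these and [S] costs at most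
   [2 * D]; enlarging [F] only raises the forced bounds. *)
exists p, S, (F :|: S :|: T p.+1); split => //.
- exact: leT.
- have : #|T p.+1| < D by rewrite ltnNge; apply/negP => /maxp; rewrite ltnn.
  have : #|F| <= (m * q) %/ t by rewrite leq_divRL // mulnC.
  move=> cF cT; apply: leq_trans (leq_card_setU _ _).1 _; rewrite mul2n -addnn addnA.
  apply: leq_add (ltnW cT); apply: leq_trans (leq_card_setU _ _).1 _.
  by rewrite cS leq_add2r.
- by rewrite -setUA setUCA subsetUl.
- by move=> s sS; have := subsetP sST s sS; rewrite inE.
- by move=> i; rewrite !inE !negb_or => /andP[_]; rewrite -leqNgt.
- move=> i s; rewrite !inE !negb_or => /andP[/andP[_ iS] _] sS lt_si.
  by rewrite ltnNge; apply: contra iS => pi; apply: top sS lt_si; rewrite inE.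
- move=> i; apply: leq_trans (unF i); apply: subset_leq_card; apply/subsetP => s.
  rewrite !inE => /andP[-> /=]; apply: leq_ltn_trans; apply: forced_subset.
  by rewrite -setUA subsetUl.
Qed.

Lemma card_le_prod_images (A : {set word}) :
  #|A| <= \prod_i #|[set k i | k : word in A]|.
Proof.
pose X i := [set k i | k : word in A].
have -> : \prod_i #|X i| = #|(family (fun i => mem (X i)) : simpl_pred word)|.
  rewrite card_family foldrE big_map big_enum /=; exact: eq_bigr.
apply: subset_leq_card; apply/subsetP => k kA; apply/familyP => i.
exact: imset_f.
Qed.

Lemma card_ord_range (X : {set 'I_q.+1}) a b :
  (forall v, v \in X -> a <= v <= b) -> #|X| <= b.+1 - a.
Proof.
move=> h; rewrite cardE -(size_iota a (b.+1 - a)) -(size_map (@nat_of_ord _)).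
apply: uniq_leq_size; first by rewrite map_inj_uniq ?enum_uniq //; apply: val_inj.
by move=> _ /mapP[v vX ->]; rewrite mem_iota; move: vX; rewrite mem_enum => /h; lia.
Qed.

(** Words that agree on [F] share all forced bounds, so the minima [lo] nearly satisfy the reflected
    inequalities. For a well chosen [s], the ranges at [i] and [refl s i] are then short together,
    except at few positions. *)
Lemma fiber_bound D B t p S F (A : {set word}) : 0 < D -> A != set0 ->
  (forall k, k \in A -> kunz k) ->
  (forall k, k \in A -> fingerprint D B t p S F k) ->
  (forall k k', k \in A -> k' \in A -> {in F, k =1 k'}) ->
  exists s tau, [/\ s \in S, D * tau <= m * t &
   #|A| ^ 2 <= (\prod_(i < m) quarter_sq (level p s i))
               * (q.+1 ^ 2) ^ (tau + 2 * B)].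
Proof.
move=> D0 /set0Pn[k0 k0A] kA sA agree.
have sp0 := sA k0 k0A.
pose kmin i : word := [arg min_(k < k0 in A) (k i : nat)].
have kminP i : kmin i \in A /\ forall k, k \in A -> kmin i i <= k i.
  by rewrite /kmin; case: arg_minnP.
pose lo i : nat := kmin i i.
pose bad s := [set i | lo i + lo (refl s i) < level p s i].
(* If [s] is not unforced for the word attaining [lo i], the forced bound at [refl s i] is at least
   [level p s i - lo i]. It depends on the values on [F] only, hence also bounds the word attaining
   the minimum there. *)
have bad_le i : #|[set s in S | i \in bad s]| <= t.
  have [kiA _] := kminP i.
  apply: leq_trans (fp_unforced (sA _ kiA) i).
  apply: subset_leq_card; apply/subsetP => s; rewrite !inE => /andP[-> /=].
  apply: contraTT; rewrite -!leqNgt => le1.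
  have [kjA _] := kminP (refl s i).
  have := forced_le_val F (refl s i) (kA _ kjA) (fp_ge (sA _ kjA)).
  rewrite -(eq_forced _ _ _ (agree _ _ kiA kjA)) -/(lo _).
  move: le1; rewrite -/(lo i); lia.
have /card_gt0P [s0 s0S] : 0 < #|S| by rewrite (fp_S sp0).
have [s sS smin] : exists2 s, s \in S & forall s', s' \in S -> #|bad s| <= #|bad s'|.
  by exists [arg min_(s < s0 in S) #|bad s|]; case: arg_minnP.
exists s, #|bad s|; split=> //.
  (* Double counting: each [i] is bad for at most [t] members of [S], and the minimum over [S] is at
     most the average. *)
  rewrite -(fp_S sp0) -sum_nat_const.
  apply: (@leq_trans (\sum_(s' in S) #|bad s'|)); first exact: leq_sum.
  have -> : \sum_(s' in S) #|bad s'| = \sum_i #|[set s' in S | i \in bad s']|.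
    under eq_bigr do rewrite -sum1_card big_mkcond /=.
    rewrite exchange_big /=; apply: eq_bigr => i _.
    rewrite -sum1_card [RHS](eq_bigl (fun s' => (s' \in S) && (i \in bad s'))) => [|s'].
      by rewrite [RHS]big_mkcondr.
    by rewrite inE.
  have <- : \sum_(j < m) t = m * t by rewrite sum_nat_const card_ord.
  by apply: leq_sum.
pose a i := #|[set k i | k : word in A]|.
have a_le i : a i <= q.+1 by rewrite -[leqRHS]card_ord max_card.
(* Reflections of [F] are excepted as well, because entries are capped by the level only outside
   [F]. *)
pose exc := bad s :|: F :|: [set refl s i | i in F].
have cexc : #|exc| <= #|bad s| + 2 * B.
  apply: leq_trans (leq_card_setU _ _).1 _; rewrite mul2n -addnn addnA.
  apply: leq_add; last exact: leq_trans (leq_imset_card _ _) (fp_F sp0).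
  by apply: leq_trans (leq_card_setU _ _).1 _; rewrite leq_add2l (fp_F sp0).
have pw i : a i * a (refl s i) <=
    quarter_sq (level p s i) * (if i \in exc then q.+1 ^ 2 else 1).
  case: ifP => [_|/negbT].
    by apply: leq_trans (leq_pmull _ (quarter_sq_gt0 _)); rewrite -mulnn leq_mul.
  rewrite !inE !negb_or -leqNgt muln1 => /andP[/andP[good iF] jF].
  have {}jF : refl s i \notin F.
    by apply: contra jF => jF; apply/imsetP; exists (refl s i); rewrite ?reflK.
  have range j : j \notin F -> (j <= s) = (i <= s) ->
      a j <= (level p s i).+1 - lo j /\ lo j <= level p s i.
    move=> jnF ej.
    have le_level k : k \in A -> k j <= level p s i.
      move=> kinA; rewrite /level -ej; case: (leqP j s) => [_|lt_sj].
        exact: (fp_le (sA _ kinA)).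
      have := fp_lt (sA _ kinA) jnF sS lt_sj; lia.
    split; last by have [? _] := kminP j; apply: le_level.
    apply: card_ord_range => v /imsetP[k kinA ->].
    by rewrite le_level // andbT; have [_] := kminP j; apply.
  have [ai li] := range i iF erefl.
  have [aj lj] := range _ jF (refl_leE s i).
  (* With [L] the level, the two lengths [L.+1 - lo] add up to at most [L + 2]. *)
  apply: leq_trans (leq_mul ai aj) _; apply: leq_mul_quarter_sq; lia.
apply: (@leq_trans ((\prod_i a i) ^ 2)); first by rewrite leq_sqr card_le_prod_images.
(* Squaring lets every position be paired with its reflection without choosing one representative
   per pair. *)
have -> : (\prod_i a i) ^ 2 = \prod_i (a i * a (refl s i)).
  rewrite -mulnn big_split /=; congr (_ * _).
  by rewrite [LHS](reindex_inj (can_inj (@reflK m s))).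
apply: leq_trans (leq_prod (fun i _ => pw i)) _.
rewrite big_split /= leq_mul2l; apply/orP; right.
rewrite -big_mkcond /= prod_nat_const leq_pexp2l // expn_gt0.
Qed.

End Kunz.

(** * Counting fingerprints and the upper bound for Kunz words *)

Definition dom_set (m : nat) (T : finType) (g : {ffun 'I_m -> option T}) : {set 'I_m} :=
  [set i | g i != None].

(* Weighting every undefined entry by [y] (an exponential Chernoff bound). *)
Lemma card_small_dom (m : nat) (T : finType) B y : 0 < y ->
  y ^ m * #|[set g : {ffun 'I_m -> option T} | #|dom_set g| <= B]|
  <= y ^ B * (y + #|T|) ^ m.
Proof.
move=> y0; pose w (o : option T) := if o is Some _ then 1 else y.
have sumw : \sum_o w o = y + #|T|.
  rewrite (bigD1 None) //= (eq_bigr (fun=> 1)) => [|[]//].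
  by rewrite sum1_card cardC1 card_option.
have -> : (y + #|T|) ^ m = \sum_(g : {ffun 'I_m -> option T}) \prod_i w (g i).
  by rewrite -(bigA_distr_bigA (fun _ : 'I_m => w)) /= sumw prod_nat_const card_ord.
rewrite mulnC -sum_nat_const big_distrr /= [leqLHS]big_mkcond /=.
apply: leq_sum => g _; rewrite inE; case: ifP => // le_B.
have -> : \prod_i w (g i) = y ^ #|~: dom_set g|.
  rewrite -prod_nat_const [RHS]big_mkcond /=; apply: eq_bigr => i _.
  by rewrite !inE negbK /w; case: (g i).
rewrite -expnD leq_pexp2l // -[leqLHS]card_ord -(cardsC (dom_set g)).
by rewrite leq_add2r.
Qed.

(** Pigeonhole with the largest fibre. [R] is a relation because one word may admit several
    fingerprints; overlapping fibres do not hurt a union bound. *)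
Lemma card_fibers (T C : finType) (A : {set T}) (codes : {set C}) (R : T -> C -> bool) :
  A != set0 -> (forall x, x \in A -> exists2 c, c \in codes & R x c) ->
  exists2 c, [set x in A | R x c] != set0 &
    #|A| <= #|codes| * #|[set x in A | R x c]|.
Proof.
move=> /set0Pn[x0 x0A] code; have [c0 c0C Rc0] := code x0 x0A.
pose fib c := [set x in A | R x c].
have [c cC cmax] : exists2 c, c \in codes & forall c', c' \in codes -> #|fib c'| <= #|fib c|.
  by exists [arg max_(c > c0 in codes) #|fib c|]; case: arg_maxnP.
exists c; rewrite -/(fib c).
  rewrite -card_gt0; apply: leq_trans (cmax _ c0C); rewrite card_gt0.
  by apply/set0Pn; exists x0; rewrite inE x0A.
rewrite -sum_nat_const; apply: (@leq_trans (\sum_(c' in codes) #|fib c'|)); last exact: leq_sum.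
have sub : A \subset \bigcup_(c in codes) fib c.
  apply/subsetP => x xA; have [c1 c1C Rx] := code x xA.
  by apply/bigcupP; exists c1 => //; rewrite inE xA.
apply: leq_trans (subset_leq_card sub) _.
elim/big_rec2: _ => [|i n B _ le]; first by rewrite cards0.
by apply: leq_trans (leq_card_setU _ _).1 _; rewrite leq_add2l.
Qed.

Lemma kunz_count_upper q m r D t y (A : {set {ffun 'I_m -> 'I_q.+1}}) :
  0 < D -> D <= m -> 0 < t -> 0 < y -> A != set0 ->
  (forall k, k \in A -> kunz k) ->
  (forall k i, k \in A -> q <= k i -> i <= r) ->
  let B := (m * q) %/ t + 2 * D in
  exists G tau, [/\ D * tau <= m * t,
    y ^ m * G <= y ^ B * (y + q.+1 * 2) ^ m &
    #|A| ^ 2 <= (q.+1 * G) ^ 2 *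
      ((\prod_(i < m) quarter_sq (level q r i)) * (q.+1 ^ 2) ^ (tau + 2 * B))].
Proof.
move=> D0 Dm t0 y0 A0 kA rA B.
(* A single partial function stores [F] as its domain, the values of the word on [F], and [S] as the
   marked part of [F]. *)
pose part := {ffun 'I_m -> option ('I_q.+1 * bool)}.
pose marked (g : part) := [set i | if g i is Some (_, b) then b else false].
pose R (k : {ffun 'I_m -> 'I_q.+1}) (c : 'I_q.+1 * part) :=
  `[< fingerprint D B t c.1 (marked c.2) (dom_set c.2) k /\
      forall i, i \in dom_set c.2 -> omap fst (c.2 i) = Some (k i) >].
pose Gs := [set g : part | #|dom_set g| <= B].
pose codes := setX [set: 'I_q.+1] Gs.
have code k : k \in A -> exists2 c, c \in codes & R k c.
  move=> kinA; have [p [S [F sp]]] := exists_fingerprint k D0 Dm t0.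
  pose g : part := [ffun i => if i \in F then Some (k i, i \in S) else None].
  have dg : dom_set g = F by apply/setP => i; rewrite inE ffunE; case: (i \in F).
  have mg : marked g = S.
    apply/setP => i; rewrite inE ffunE; case: ifP => // /negbT iF.
    by apply/esym/negP => iS; move: iF; rewrite (subsetP (fp_sub sp)).
  exists (inord p, g); first by rewrite !inE /= dg (fp_F sp).
  apply/asboolP; rewrite /= dg mg inordK ?ltnS ?(fp_p sp) //; split=> // i iF.
  by rewrite ffunE iF.
have [[p g] f0 cardA] := card_fibers A0 code.
set S := marked g; set F := dom_set g in f0 cardA.
set fib := [set x in A | _] in f0 cardA.
have fibA k : k \in fib -> k \in A by rewrite inE => /andP[].
have fibR k : k \in fib -> fingerprint D B t p S F k /\
   forall i, i \in F -> omap fst (g i) = Some (k i).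
  by rewrite inE => /andP[_ /asboolP].
have agree k k' : k \in fib -> k' \in fib -> {in F, k =1 k'}.
  by move=> /fibR[_ h] /fibR[_ h'] i iF; apply/Some_inj; rewrite -h // h'.
have [s [tau [sS tauD le_fib]]] :=
  fiber_bound D0 f0 (fun k h => kA k (fibA k h)) (fun k h => (fibR k h).1) agree.
exists #|Gs|, tau; split=> //.
  by have := card_small_dom m ('I_q.+1 * bool)%type B y0; rewrite card_prod card_ord card_bool.
have cardC : #|codes| = q.+1 * #|Gs| by rewrite cardsX cardsT card_ord.
apply: (@leq_trans ((#|codes| * #|fib|) ^ 2)); first by rewrite leq_sqr.
rewrite expnMn cardC leq_mul2l; apply/orP; right; apply: leq_trans le_fib _.
rewrite leq_mul2r; apply/orP; right; apply: leq_prod => i _; apply: leq_quarter_sq.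
have /set0Pn [k kf] := f0; have [sp _] := fibR k kf.
have pks := fp_ge sp sS; have ltk := ltn_ord (k s).
(* The levels for [(p, s)] are at most those for [(q, r)]: if [p = q], the entry at [s] is [q] and
   hence [s <= r]; otherwise [p] is at most [q - 1], the smaller of the two levels. *)
have [eqpq|nepq] := eqVneq (p : nat) q.
  have le_sr : s <= r by apply: (rA k s (fibA k kf)); rewrite -[leqLHS]eqpq.
  by rewrite /level eqpq; case: (leqP i s); case: (leqP i r); lia.
have := ltn_ord p; move/eqP: nepq; rewrite /level.
by case: (leqP i s); case: (leqP i r); lia.
Qed.

(** * Correspondence between semigroups and Kunz words *)

Definition memb (f : nat) (S : {set 'I_f.+1}) (x : nat) : bool :=
  (x <= f) ==> (inord x \in S).

Lemma membP f (S : {set 'I_f.+1}) x : reflect (ext_set S x) (memb S x).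
Proof. by rewrite /memb /ext_set; case: (x <= f) => /=; apply: idP. Qed.

Lemma memb_ord f (S : {set 'I_f.+1}) (x : 'I_f.+1) : memb S x = (x \in S).
Proof. by rewrite /memb -ltnS ltn_ord inord_val. Qed.

Lemma memb_gt f (S : {set 'I_f.+1}) x : f < x -> memb S x.
Proof. by rewrite /memb ltnNge => /negbTE ->. Qed.

Lemma divn_mod_eq m (i : 'I_m) n : ((n * m + i) %/ m = n) * ((n * m + i) %% m = i).
Proof.
have m0 : 0 < m by apply: leq_ltn_trans (ltn_ord i).
by rewrite divnMDl // divn_small // addn0 modnMDl modn_small.
Qed.

Section SemigroupWords.
Variables (q m r : nat).
Hypotheses (q_gt0 : 0 < q) (r_gt0 : 0 < r) (r_ltm : r < m).
Let f := (q - 1) * m + r.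
Local Notation word := {ffun 'I_m -> 'I_q.+1}.

Let m_gt0 : 0 < m. Proof. exact: ltn_trans r_ltm. Qed.

Let residue (x : nat) : 'I_m := Ordinal (ltn_pmod x m_gt0).

Let residueE (i : 'I_m) n : residue (n * m + i) = i.
Proof. by apply: val_inj; rewrite /= divn_mod_eq. Qed.

Let in_N_count (S : {set 'I_f.+1}) : Prop :=
  is_numerical_semigroup (ext_set S) /\ has_multiplicity (ext_set S) m /\
  has_frobenius (ext_set S) f.

(** A failed search returns [q], which is the correct entry, since [q * m + i] always exceeds
    [f]. *)
Definition kunz_word (S : {set 'I_f.+1}) : word :=
  [ffun i => inord (find (fun n => memb S (n * m + (i : 'I_m))) (iota 0 q))].

(** Closure under adding [m] makes membership monotone in [n], so the first hit decides it. *)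
Lemma kunz_wordE S (i : 'I_m) n : in_N_count S ->
  memb S (n * m + i) = (kunz_word S i <= n).
Proof.
move=> [[_ [addS _]] [[_ [mS _]] _]].
have step n1 d : memb S (n1 * m + i) -> memb S ((n1 + d) * m + i).
  move=> h; elim: d => [|d IH]; first by rewrite addn0.
  have -> : (n1 + d.+1) * m + i = (n1 + d) * m + i + m by rewrite addnS mulSn; lia.
  by apply/membP/addS => //; apply/membP.
rewrite ffunE inordK; last by rewrite ltnS -[leqRHS](size_iota 0) find_size.
set P := fun n => _; apply/idP/idP => [Pn|].
  have [ltnq|leqn] := ltnP n q; last by apply: leq_trans leqn; rewrite -[leqRHS](size_iota 0) find_size.
  rewrite leqNgt; apply/negP => /(before_find 0).
  by rewrite nth_iota // add0n /P Pn.
move=> le_n; have [hasP|nhasP] := boolP (has P (iota 0 q)).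
  rewrite -(subnKC le_n); apply: step.
  have := nth_find 0 hasP; rewrite nth_iota //; move: hasP; rewrite has_find size_iota //.
move: le_n; rewrite hasNfind // size_iota => le_n; apply: memb_gt.
by rewrite /f; have := ltn_ord i; nia.
Qed.

Lemma exists_kunz_words : exists A : {set word},
  [/\ #|A| = N_count f m, forall k, k \in A -> kunz k &
      forall (k : word) (i : 'I_m), k \in A -> q <= k i -> i <= r].
Proof.
pose X := [set S | `[< in_N_count S >]].
have XP S : S \in X -> in_N_count S by rewrite inE => /asboolP.
exists (kunz_word @: X); split.
- rewrite card_in_imset // => S S' /XP SX /XP S'X eqk; apply/setP => x.
  have inE0 S0 : in_N_count S0 -> (x \in S0) = (kunz_word S0 (residue x) <= x %/ m).
    by move=> S0X; rewrite -memb_ord -kunz_wordE //; congr memb; apply: divn_eq.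
  by rewrite !inE0 // eqk.
- move=> _ /imsetP[S /XP SX ->] i j l.
  have [[_ [addS _]] _] := SX.
  have Si u : memb S (kunz_word S u * m + u) by rewrite kunz_wordE.
  have /membP Sij := addS _ _ (elimT (membP _ _) (Si i)) (elimT (membP _ _) (Si j)).
  split=> e; rewrite -(kunz_wordE _ _ SX).
    by move: Sij; congr memb; rewrite mulnDl -e; lia.
  by move: Sij; congr memb; rewrite !mulnDl mul1n -!addnA -e; lia.
- move=> k i /imsetP[S /XP SX ->] le_q; rewrite leqNgt; apply/negP => lt_ri.
  have : memb S ((q - 1) * m + i) by apply: memb_gt; rewrite /f ltn_add2l.
  by rewrite kunz_wordE //; lia.
Qed.

(** The inverse encoding. Zeros exactly at position 0 give multiplicity [m], the bounds by [q] put
    everything beyond [f] into the semigroup, and the entry [q] at [r] keeps [f] out. *)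
Lemma kunz_words_le_N_count (A : {set word}) :
  (forall k, k \in A -> kunz k) ->
  (forall (k : word) (i : 'I_m), k \in A -> (k i == 0 :> nat) = (i == 0 :> nat)) ->
  (forall (k : word) (i : 'I_m), k \in A -> r < i -> k i < q) ->
  (forall (k : word) (i : 'I_m), k \in A -> i = r :> nat -> k i = q :> nat) ->
  #|A| <= N_count f m.
Proof.
move=> kA zA ltA eqA.
pose Sg (k : word) : {set 'I_f.+1} := [set x : 'I_f.+1 | k (residue x) <= x %/ m].
have SgE k x : k \in A -> memb (Sg k) x = (k (residue x) <= x %/ m).
  move=> kinA; rewrite /memb; have [le_xf|lt_fx] := leqP x f.
    by rewrite inE inordK.
  suff -> : k (residue x) <= x %/ m by [].
  have := ltn_ord (k (residue x)); rewrite ltnS => le_kq.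
  have := divn_eq x m; have := ltn_pmod x m_gt0; move: lt_fx; rewrite /f => h1 h2 h3.
  (* Beyond [f] the quotient is at least [q - 1], and at least [q] when the residue is at most
     [r]. *)
  have [lt_r|le_r] := ltnP r (residue x).
    have := ltA k _ kinA lt_r; have : q - 1 <= x %/ m by rewrite leq_divRL //; lia.
    by move=> le_d lt_k; apply: leq_trans le_d; rewrite leq_subRL // add1n.
  apply: leq_trans le_kq _; rewrite leqNgt; apply/negP => lt_q.
  have /leq_mul /(_ (leqnn m)) : x %/ m <= q - 1 by rewrite leq_subRL // add1n.
  by move: le_r h1; rewrite /= {2}(divn_eq x m); lia.
have injS : {in A &, injective Sg}.
  move=> k k' kinA k'inA eqS; apply/ffunP => i; apply: ord_inj.
  have e n : (k i <= n) = (k' i <= n).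
    have := SgE k (n * m + i) kinA; rewrite eqS SgE // residueE divn_mod_eq.
    by move->.
  by apply/eqP; rewrite eqn_leq e leqnn -e leqnn.
rewrite -(card_in_imset injS); apply: subset_leq_card; apply/subsetP => _ /imsetP[k kinA ->].
have extE x : ext_set (Sg k) x <-> k (residue x) <= x %/ m.
  by rewrite -SgE //; split=> /membP.
rewrite inE; apply/asboolP; split; first split; last (split; first split).
- by apply/extE; rewrite div0n leqn0 zA //= mod0n.
- split=> [x y /extE hx /extE hy|]; last first.
    by exists f.+1 => n lt_fn; apply/membP/memb_gt.
  apply/extE; have [h1 h2] := kA k kinA (residue x) (residue y) (residue (x + y)).
  move: h1 h2; rewrite /= modnD // divnD //; case: leqP => le_m h1 h2.
    apply: leq_trans (h2 _) _; first by rewrite mul1n subnKC.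
    by rewrite leq_add2r leq_add.
  apply: leq_trans (h1 _) _; first by rewrite mul0n subn0.
  by rewrite addn0 leq_add.
- by [].
- split=> [|x x0]; first apply/extE.
    by have := zA k (residue m) kinA; rewrite /= modnn divnn m_gt0 eqxx => /eqP ->.
  move=> ltxm /extE; rewrite divn_small // leqn0 zA //= modn_small //; lia.
- split=> [n lt_fn|c' hc']; first by apply/membP/memb_gt.
  rewrite ltnNge; apply/negP => le_c; have /extE := hc' f le_c.
  rewrite (eqA k _ kinA); last by rewrite /= /f modnMDl modn_small.
  by rewrite /f divnMDl // divn_small //; lia.
Qed.

End SemigroupWords.

(** * The box of words for the lower bound *)

Lemma quarter_sq_double h : quarter_sq h.*2 = h.+1 * h.+1.
Proof.
by rewrite /quarter_sq (_ : _ ^ 2 = (h.+1 * h.+1) * 4) ?mulnK // -mulnn; nia.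
Qed.

Lemma quarter_sq_doubleS h : quarter_sq h.*2.+1 = h.+1 * h.+2.
Proof.
rewrite /quarter_sq (_ : _ ^ 2 = (h.+1 * h.+2) * 4 + 1); last by rewrite -mulnn; nia.
by rewrite divnMDl // addn0.
Qed.

Lemma card_ord_itv n a b : b <= n ->
  b.+1 - a <= #|[set v : 'I_n.+1 | a <= v <= b]|.
Proof.
move=> le_bn; rewrite -[leqLHS](size_iota a) cardE -(size_map (@nat_of_ord _)).
apply: uniq_leq_size (iota_uniq _ _) _ => x; rewrite mem_iota => x_in.
apply/mapP; exists (inord x); last by rewrite inordK; lia.
by rewrite mem_enum inE inordK; lia.
Qed.

Section LowerBox.
Variables (q m r : nat).
Hypotheses (q_ge3 : 3 <= q) (r_gt0 : 0 < r) (r_ltm : r < m).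
Local Notation word := {ffun 'I_m -> 'I_q.+1}.

(* Lower ends of the intervals of a box of words whose pairwise sums always
   satisfy the Kunz inequalities; at most one of [i] and its reflection [r - i]
   (mod m) gets the smaller value when the parity of [q] or [q - 1] asks for it. *)
Definition box_lo (i : nat) : nat :=
  if odd q then (if i.*2 <= r then (q./2).+1 else q./2)
  else (if i.*2 <= m + r then q./2 else (q./2).-1).

Lemma box_lo_gt0 i : 0 < box_lo i.
Proof. by rewrite /box_lo; have := odd_double_half q; case: (odd q); case: ifP; lia. Qed.

Lemma box_lo_le i : box_lo i <= level q r i.
Proof.
rewrite /box_lo /level; have := odd_double_half q.
by case: (odd q); do ?[case: ifP => ?]; lia.
Qed.

Lemma box_lo_add i j : i + j < m -> level q r (i + j) <= box_lo i + box_lo j.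
Proof.
move=> lt_ijm; rewrite /box_lo /level; have := odd_double_half q.
by case: (odd q); do ?[case: ifP => ?]; lia.
Qed.

Lemma box_lo_add_wrap i j l : i < m -> j < m -> i + j = m + l ->
  level q r l <= box_lo i + box_lo j + 1.
Proof.
move=> lt_im lt_jm eij; rewrite /box_lo /level; have := odd_double_half q.
by case: (odd q); do ?[case: ifP => ?]; lia.
Qed.

(** Positions 0 and [r] are pinned so that the multiplicity and the Frobenius number come out
    right. *)
Definition box_set (i : 'I_m) : {set 'I_q.+1} :=
  if i == 0 :> nat then [set ord0] else
  if i == r :> nat then [set ord_max] else
  [set v : 'I_q.+1 | box_lo i <= v <= level q r i].

Definition box : {set word} := [set k : word | [forall i, k i \in box_set i]].

Lemma level_le i : level q r i <= q.
Proof. by rewrite /level; case: ifP; lia. Qed.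

Lemma box_set_gt0 i : 0 < #|box_set i|.
Proof.
rewrite /box_set; do 2 (case: ifP; first by rewrite cards1).
move=> _ _; apply: leq_trans (card_ord_itv _ (level_le _)).
by have := box_lo_le i; lia.
Qed.

Lemma box_valP (k : word) (i : 'I_m) : k \in box ->
  [/\ i = 0 :> nat -> k i = 0 :> nat, i = r :> nat -> k i = q :> nat,
      i != 0 :> nat -> box_lo i <= k i & k i <= level q r i].
Proof.
rewrite inE => /forallP /(_ i); rewrite /box_set.
case: ifP => [/eqP i0 | ni0]; first by rewrite inE => /eqP -> /=; split=> //; lia.
case: ifP => [/eqP ir | nir]; rewrite inE.
  move=> /eqP -> /=; split=> // [|_|]; first lia.
    exact: leq_trans (box_lo_le _) (level_le _).
  by rewrite /level ir leqnn.
by move=> /andP[h1 h2]; split=> // e; move: ni0 nir; rewrite e eqxx.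
Qed.

Lemma box_kunz k : k \in box -> kunz k.
Proof.
move=> kb i j l.
have [i0 _ ilo _] := box_valP i kb; have [j0 _ jlo _] := box_valP j kb.
have [_ _ _ lhi] := box_valP l kb.
(* The pinned entry 0 lies below [box_lo], so sums involving position 0 are treated apart; there the
   inequality is trivial. *)
have [iz|inz] := eqVneq (i : nat) 0.
  have eqjl : i + j = l -> j = l by move=> e; apply: ord_inj; lia.
  split=> [/eqjl ->|]; first exact: leq_addl.
  by have := ltn_ord j; lia.
have [jz|jnz] := eqVneq (j : nat) 0.
  have eqil : i + j = l -> i = l by move=> e; apply: ord_inj; lia.
  split=> [/eqil ->|]; first exact: leq_addr.
  by have := ltn_ord i; lia.
split=> e; apply: leq_trans lhi _.
  rewrite -e; apply: leq_trans (box_lo_add _) (leq_add (ilo inz) (jlo jnz)).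
  by rewrite e.
apply: leq_trans (box_lo_add_wrap (ltn_ord i) (ltn_ord j) e) _.
by rewrite leq_add2r (leq_add (ilo inz) (jlo jnz)).
Qed.

Lemma card_box : #|box| = \prod_i #|box_set i|.
Proof.
have -> : \prod_i #|box_set i| = #|(family (fun i => mem (box_set i)) : simpl_pred word)|.
  rewrite card_family foldrE big_map big_enum /=; exact: eq_bigr.
by apply: eq_card => k; rewrite inE; apply/forallP/familyP.
Qed.

(** The two sides differ in length by at most 1 and have the extremal sum. The exceptions are the
    pinned positions 0 and [r] and the possible fixed points [r./2] and [(m + r)./2] of the
    reflection. *)
Lemma box_pair (i : 'I_m) (s : 'I_m) : s = r :> nat ->
  quarter_sq (level q r i) <= #|box_set i| * #|box_set (refl s i)| *
    (if (i : nat) \in [:: 0; r; r./2; (m + r)./2] then quarter_sq q else 1).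
Proof.
move=> sr; case: ifP => [_|].
  apply: leq_trans (leq_quarter_sq (level_le i)) _.
  by apply: leq_pmull; rewrite muln_gt0 !box_set_gt0.
rewrite !inE => /negbT; rewrite !negb_or => /and4P[i0 ir ir2 imr2]; rewrite muln1.
have jE := val_refl s i; have jle := refl_leE s i; have lt_im := ltn_ord i.
move: (refl s i) jE jle => j; rewrite sr => jE jle.
have lev : level q r j = level q r i by rewrite /level jle.
have j0 : (j == 0 :> nat) = false by rewrite jE; apply/eqP; case: ifP; lia.
have jr : (j == r :> nat) = false by rewrite jE; apply/eqP; case: ifP; lia.
rewrite /box_set (negbTE i0) (negbTE ir) j0 jr lev.
apply: leq_trans (leq_mul (card_ord_itv _ (level_le _)) (card_ord_itv _ (level_le _))).
have {}ir2 : i.*2 <> r by move=> e; move: ir2; rewrite -e doubleK eqxx.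
have {}imr2 : i.*2 <> m + r by move=> e; move: imr2; rewrite -e doubleK eqxx.
have := odd_double_half q; rewrite /box_lo; set h := q./2.
case: (odd q) => half; have [le_ir|lt_ri] := leqP i r.
- have lvl : level q r i = h.*2.+1 by rewrite /level le_ir; lia.
  move: jE; rewrite le_ir lvl quarter_sq_doubleS => jE.
  have [le_i|lt_i] := leqP i.*2 r; have [le_j|lt_j] := leqP j.*2 r; lia.
- have lvl : level q r i = h.*2 by rewrite /level leqNgt lt_ri /=; lia.
  move: jE; rewrite leqNgt lt_ri lvl quarter_sq_double /= => jE.
  by apply: leq_mul; case: ifP; lia.
- have lvl : level q r i = h.*2 by rewrite /level le_ir; lia.
  move: jE; rewrite le_ir lvl quarter_sq_double => jE.
  by apply: leq_mul; case: ifP; lia.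
have [h' eh] : exists h', h = h'.+1 by exists h.-1; lia.
have lvl : level q r i = h'.*2.+1 by rewrite /level leqNgt lt_ri /=; lia.
move: jE; rewrite leqNgt lt_ri lvl quarter_sq_doubleS eh /= => jE.
have [le_i|lt_i] := leqP i.*2 (m + r); have [le_j|lt_j] := leqP j.*2 (m + r); lia.
Qed.

(** In the product of [box_pair] over all [i] each side occurs twice, whence the square; the four
    exceptions give the fourth power. *)
Lemma prod_level_le_N_count :
  \prod_(i < m) quarter_sq (level q r i)
  <= N_count ((q - 1) * m + r) m ^ 2 * quarter_sq q ^ 4.
Proof.
have le_box : #|box| <= N_count ((q - 1) * m + r) m.
  apply: kunz_words_le_N_count => //; try lia.
  - exact: box_kunz.
  - move=> k i /(box_valP i)[h0 _ hlo _].
    have [i0|/hlo] := eqVneq (i : nat) 0; first by rewrite h0.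
    by have := box_lo_gt0 i; case: eqP; lia.
  - move=> k i /(box_valP i)[_ _ _ hi] lt_ri; move: hi.
    by rewrite /level; case: (leqP i r) lt_ri; lia.
  - by move=> k i /(box_valP i)[].
apply: (@leq_trans (#|box| ^ 2 * quarter_sq q ^ 4)); last first.
  by rewrite leq_mul2r leq_sqr le_box orbT.
pose s := Ordinal r_ltm.
apply: leq_trans (leq_prod (fun i _ => @box_pair i s erefl)) _.
rewrite big_split /= big_split /= card_box -mulnn.
have <- : \prod_i #|box_set i| = \prod_i #|box_set (refl s i)|.
  by rewrite [LHS](reindex_inj (can_inj (@reflK m s))).
rewrite leq_mul2l; apply/orP; right.
rewrite -big_mkcond /= prod_nat_const leq_pexp2l ?quarter_sq_gt0 //.
rewrite cardE -(size_map (@nat_of_ord _)) -[4]/(size [:: 0; r; r./2; (m + r)./2]).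
apply: uniq_leq_size; first by rewrite map_inj_uniq ?enum_uniq //; apply: ord_inj.
by move=> _ /mapP[i + ->]; rewrite mem_enum.
Qed.

End LowerBox.

(** * Logarithms, choice of parameters, and the asymptotic formula *)

Lemma ln_le x y : (0 < x)%Re -> (x <= y)%Re -> (ln x <= ln y)%Re.
Proof.
by move=> x0 [/(ln_increasing _ _ x0) ?|->]; [apply: Rlt_le | apply: Rle_refl].
Qed.

Definition lnn (n : nat) : R := ln (INR n).

Lemma INR_leq a b : a <= b -> (INR a <= INR b)%Re.
Proof. by move/leP; apply: le_INR. Qed.

Lemma INR_gt0 n : 0 < n -> (0 < INR n)%Re.
Proof. by move/ltP; apply: lt_0_INR. Qed.

Lemma INR_muln a b : INR (a * b) = (INR a * INR b)%Re.
Proof. exact: mult_INR. Qed.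

Lemma INR_addn a b : INR (a + b) = (INR a + INR b)%Re.
Proof. exact: plus_INR. Qed.

Lemma lnn_mul a b : 0 < a -> 0 < b -> lnn (a * b) = (lnn a + lnn b)%Re.
Proof. by move=> a0 b0; rewrite /lnn INR_muln ln_mult //; apply: INR_gt0. Qed.

Lemma lnn_exp a n : 0 < a -> lnn (a ^ n) = (INR n * lnn a)%Re.
Proof.
move=> a0; elim: n => [|n IH]; first by rewrite expn0 /lnn ln_1 /=; lra.
by rewrite expnS lnn_mul ?expn_gt0 ?a0 // IH S_INR; lra.
Qed.

Lemma lnn_leq a b : 0 < a -> a <= b -> (lnn a <= lnn b)%Re.
Proof. by move=> a0 ab; apply: ln_le; [apply: INR_gt0 | apply: INR_leq]. Qed.

Lemma lnn_ge0 a : 0 < a -> (0 <= lnn a)%Re.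
Proof. by move=> a0; rewrite -ln_1; apply: (@lnn_leq 1). Qed.

Lemma lnn_add_le y Q : 0 < y -> (lnn (y + Q) <= lnn y + INR Q / INR y)%Re.
Proof.
move=> y0; have y0' := INR_gt0 y0; rewrite /lnn INR_addn.
have -> : (INR y + INR Q = INR y * (1 + INR Q / INR y))%Re by field; lra.
have Qy : (0 <= INR Q / INR y)%Re by apply: Rle_mult_inv_pos => //; apply: pos_INR.
rewrite ln_mult //; last lra.
apply: Rplus_le_compat_l; rewrite -{2}(ln_exp (INR Q / INR y)).
by apply: ln_le; [lra | apply: exp_ineq1_le].
Qed.

Lemma archimed_nat (C e : R) : (0 < e)%Re -> exists2 n, 0 < n & (C <= e * INR n)%Re.
Proof.
move=> e0; have [n h] := INR_unbounded (C / e); exists n.+1 => //.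
have -> : C = (e * (C / e))%Re by field; lra.
apply: Rmult_le_compat_l; first lra.
by rewrite S_INR; lra.
Qed.

Lemma prod_level q m r : r < m ->
  \prod_(i < m) quarter_sq (level q r i) =
  quarter_sq q ^ r.+1 * quarter_sq q.-1 ^ (m - r.+1).
Proof.
move=> lt_rm; rewrite -(big_mkord xpredT (fun i => quarter_sq (level q r i))).
rewrite (big_cat_nat _ (n := r.+1)) //=; congr (_ * _).
  rewrite -[X in _ ^ X]subn0 -prod_nat_const_nat; apply: eq_big_nat => i /andP[_ lt_ir].
  by rewrite /level -ltnS lt_ir.
rewrite -prod_nat_const_nat; apply: eq_big_nat => i /andP[lt_ri _].
by rewrite /level leqNgt lt_ri.
Qed.

Lemma ln_c_ q : ln (c_ q) = (lnn (quarter_sq q) / 2)%Re.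
Proof.
have q0 : (0 < INR (quarter_sq q))%Re by apply/INR_gt0/quarter_sq_gt0.
have := sqrt_lt_R0 _ q0; rewrite -/(c_ q) => c0.
have := ln_mult _ _ c0 c0; rewrite {1 2}/c_ sqrt_sqrt; last exact: Rlt_le q0.
by rewrite -/(quarter_sq q) -/(lnn _); lra.
Qed.

Lemma ln_N_count q : 3 <= q -> forall eta, (0 < eta)%Re ->
  exists M, forall m r, M <= m -> 0 < r -> r < m ->
    0 < N_count ((q - 1) * m + r) m /\
    (Rabs (lnn (N_count ((q - 1) * m + r) m)
       - (INR r * ln (c_ q) + (INR m - INR r) * ln (c_ (q - 1))))
     <= eta * INR m)%Re.
Proof.
move=> q3 eta eta0.
pose lq := lnn (quarter_sq q); pose lq1 := lnn (quarter_sq (q - 1)); pose lQ := lnn q.+1.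
have lq1_ge0 : (0 <= lq1)%Re by apply/lnn_ge0/quarter_sq_gt0.
have lq1_le : (lq1 <= lq)%Re.
  by apply: lnn_leq (quarter_sq_gt0 _) (leq_quarter_sq (leq_subr _ _)).
have lQ_ge0 : (0 <= lQ)%Re by apply: lnn_ge0.
have eta4 : (0 < eta / 4)%Re by lra.
(* Large [y] makes the Chernoff loss [INR (q.+1 * 2) / INR y] per position at most [eta / 4]. *)
have [y y0 hy] := archimed_nat (INR (q.+1 * 2)) eta4.
have ly_ge0 := lnn_ge0 y0.
(* Large [t] controls the part of the overhead linear in [m]: with [D = t * t], both [tau] and the
   main term of [B] are of order [m / t]. *)
have [t t0 ht] := archimed_nat (INR q * lnn y + lQ + 2 * INR q * lQ) eta4.
pose D := t * t.
(* What remains is constant in [m], including the four exceptions of the box and the extra factor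
   from [r.+1] in [prod_level]. *)
have [M M0 hM] := archimed_nat (lQ + 2 * INR D * (lnn y + 2 * lQ) + 2 * lq) eta4.
exists (maxn M D) => m r; rewrite geq_max => /andP[leM leD] r0 rm.
have q0 : 0 < q by lia.
set n := N_count _ _.
have m0 : 0 < m by lia.
have Im0 := INR_gt0 m0; have It0 := INR_gt0 t0.
pose W := \prod_(i < m) quarter_sq (level q r i).
have W0 : 0 < W by apply: prodn_gt0 => i; apply: quarter_sq_gt0.
have lW : lnn W = ((INR r + 1) * lq + (INR m - INR r - 1) * lq1)%Re.
  rewrite /W prod_level // lnn_mul ?expn_gt0 ?quarter_sq_gt0 // !lnn_exp ?quarter_sq_gt0 //.
  rewrite -subn1 S_INR -/lq -/lq1; congr (_ + _ * _)%Re.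
  by rewrite minus_INR; [rewrite S_INR; lra | apply/leP].
have low : W <= n ^ 2 * quarter_sq q ^ 4 := prod_level_le_N_count q3 r0 rm.
have n0 : 0 < n.
  by case: (posnP n) low => // ->; rewrite exp0n // mul0n leqNgt W0.
split=> //; set x := lnn n.
have lowR : (lnn W <= 2 * x + 4 * lq)%Re.
  have := lnn_leq W0 low.
  rewrite lnn_mul ?expn_gt0 ?n0 ?quarter_sq_gt0 // !lnn_exp ?quarter_sq_gt0 //.
  by rewrite -/x -/lq /=; lra.
have [A [cA kA rA]] := exists_kunz_words q0 r0 rm.
rewrite -/n in cA.
have A0 : A != set0 by rewrite -card_gt0 cA.
have D0 : 0 < D by rewrite muln_gt0 t0.
have [G [tau [htau hG hA]]] := kunz_count_upper D0 leD t0 y0 A0 kA rA.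
set B := _ + _ in hG hA.
have G0 : 0 < G.
  by case: (posnP G) hA => // ->; rewrite muln0 exp0n // mul0n cA leqNgt expn_gt0 n0.
have upG : (INR m * lnn y + lnn G <= INR B * lnn y + INR m * lnn (y + q.+1 * 2))%Re.
  have := lnn_leq _ hG; rewrite !lnn_mul ?expn_gt0 ?y0 ?addn_gt0 ?y0 // !lnn_exp ?addn_gt0 ?y0 //.
  by apply; rewrite muln_gt0 expn_gt0 y0.
have upA : (2 * x <= 2 * (lQ + lnn G) + (lnn W + (INR tau + 2 * INR B) * (2 * lQ)))%Re.
  have qG0 : 0 < q.+1 * G by rewrite muln_gt0.
  have e1 : lnn (n ^ 2) = (2 * x)%Re by rewrite lnn_exp // -/x /=; lra.
  have e2 : lnn ((q.+1 * G) ^ 2) = (2 * (lQ + lnn G))%Re.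
    by rewrite lnn_exp // lnn_mul // -/lQ /=; lra.
  have e3 : lnn ((q.+1 ^ 2) ^ (tau + 2 * B)) = ((INR tau + 2 * INR B) * (2 * lQ))%Re.
    by rewrite lnn_exp ?expn_gt0 // lnn_exp // INR_addn INR_muln -/lQ /=; lra.
  have := lnn_leq _ hA; rewrite cA expn_gt0 n0 => /(_ isT).
  have Q0 : 0 < (q.+1 ^ 2) ^ (tau + 2 * B) by rewrite !expn_gt0.
  rewrite -/W (@lnn_mul ((q.+1 * G) ^ 2)); first by rewrite (lnn_mul W0 Q0) e1 e2 e3.
    by rewrite expn_gt0 qG0.
  by rewrite muln_gt0 W0.
have upy := lnn_add_le (q.+1 * 2) y0.
have tau_le : (INR tau * INR t <= INR m)%Re.
  rewrite -INR_muln; apply: INR_leq.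
  by move: htau; rewrite /D -mulnA mulnC leq_pmul2r // mulnC.
have B_le : (INR B * INR t <= INR m * INR q + 2 * INR D * INR t)%Re.
  have : B * t <= m * q + 2 * D * t by rewrite mulnDl leq_add2r leq_trunc_div.
  by move/INR_leq; rewrite INR_addn !INR_muln.
rewrite !ln_c_ -/lq -/lq1.
have hMm : (lQ + 2 * INR D * (lnn y + 2 * lQ) + 2 * lq <= eta / 4 * INR m)%Re.
  by apply: Rle_trans hM _; apply: Rmult_le_compat_l; [lra | apply: INR_leq].
have Qy : (INR (q.+1 * 2) / INR y <= eta / 4)%Re.
  have Iy0 := INR_gt0 y0; apply: (Rmult_le_reg_r (INR y)) => //.
  by rewrite /Rdiv Rmult_assoc Rinv_l; lra.
have upG' : (lnn G <= INR B * lnn y + INR m * (eta / 4))%Re.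
  have := Rmult_le_compat_l (INR m) _ _ (Rlt_le _ _ Im0)
    (Rle_trans _ _ _ upy (Rplus_le_compat_l (lnn y) _ _ Qy)).
  lra.
have overhead : (INR B * (lnn y + 2 * lQ) + INR tau * lQ
                 <= INR m * (eta / 4) + 2 * INR D * (lnn y + 2 * lQ))%Re.
  apply: (Rmult_le_reg_r (INR t)) => //.
  have z0 : (0 <= lnn y + 2 * lQ)%Re by lra.
  have h1 := Rmult_le_compat_r _ _ _ z0 B_le.
  have h2 := Rmult_le_compat_r _ _ _ lQ_ge0 tau_le.
  have h3 := Rmult_le_compat_l (INR m) _ _ (Rlt_le _ _ Im0) ht.
  lra.
have em0 : (0 < eta * INR m)%Re by apply: Rmult_lt_0_compat.
have lq0 : (0 <= INR D * (lnn y + 2 * lQ))%Re.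
  by apply: Rmult_le_pos; [apply: pos_INR | lra].
by apply: Rabs_le; split; lra.
Qed.

Theorem theorem1p3 (q : nat) (hq : (3 <= q)%N) :
  forall eps : R, Rlt R0 eps ->
  exists M : nat, forall f m : nat,
    (M <= m)%N -> ((q - 1) * m < f)%N -> (f < q * m)%N ->
    exists E : R,
      INR (N_count f m) =
        Rpower (Rmult (Rpower (c_ q) (alpha q f m))
                      (Rpower (c_ (q - 1)) (Rminus R1 (alpha q f m))))
               (Rplus (INR m) E)
      /\ Rle (Rabs E) (Rmult eps (INR m)).
Proof.
move=> eps eps0.
(* Here [q >= 3] gives [quarter_sq (q - 1) >= 4]; positivity of this logarithm permits the later
   division by [lam]. *)
have c1_gt0 : (0 < ln (c_ (q - 1)))%Re.
  rewrite ln_c_ /lnn.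
  suff : (0 < ln (INR (quarter_sq (q - 1))))%Re by lra.
  rewrite -ln_1; apply: ln_increasing; first lra.
  have h : 4 <= quarter_sq (q - 1) by apply: (@leq_quarter_sq 2); lia.
  by have := INR_leq h; rewrite /=; lra.
have c_le : (ln (c_ (q - 1)) <= ln (c_ q))%Re.
  rewrite !ln_c_; suff : (lnn (quarter_sq (q - 1)) <= lnn (quarter_sq q))%Re by lra.
  exact: lnn_leq (quarter_sq_gt0 _) (leq_quarter_sq (leq_subr _ _)).
(* The error in the logarithm is divided by [lam], which is at least [ln (c_ (q - 1))]; scaling
   [eps] by that logarithm compensates. *)
have eta0 : (0 < eps * ln (c_ (q - 1)))%Re by apply: Rmult_lt_0_compat.
have [M hM] := ln_N_count hq eta0.
exists (maxn M 1) => f m; rewrite geq_max => /andP[leM m0] lt_f f_lt.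
pose r := f - (q - 1) * m.
have fE : f = (q - 1) * m + r by rewrite subnKC // ltnW.
have lt_rm : r < m by rewrite -(ltn_add2l ((q - 1) * m)) -fE -mulSnr subn1 prednK //; lia.
have [N0 bound] := hM m r leM ltac:(by rewrite subn_gt0) lt_rm.
rewrite -fE in N0 bound.
have Im0 := INR_gt0 m0.
have alphaE : alpha q f m = (INR r / INR m)%Re.
  rewrite /alpha fE INR_addn INR_muln minus_INR; last by apply/leP; lia.
  by rewrite [INR 1]/=; field; lra.
set a := alpha q f m in alphaE *.
have a_ge0 : (0 <= a)%Re.
  by rewrite alphaE; apply: Rle_mult_inv_pos => //; apply: pos_INR.
pose lam := (a * ln (c_ q) + (1 - a) * ln (c_ (q - 1)))%Re.
have lam_ge : (ln (c_ (q - 1)) <= lam)%Re.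
  have := Rmult_le_compat_l a _ _ a_ge0 c_le; rewrite /lam; lra.
have lamm : (lam * INR m = INR r * ln (c_ q) + (INR m - INR r) * ln (c_ (q - 1)))%Re.
  by rewrite /lam alphaE; field; lra.
rewrite -lamm -/(lnn _) in bound.
have -> : Rmult (Rpower (c_ q) a) (Rpower (c_ (q - 1)) (Rminus R1 a)) = exp lam.
  by rewrite /Rpower -exp_plus.
(* This [E] makes the formula exact, so only its size needs an estimate. *)
exists (lnn (N_count f m) / lam - INR m)%Re; split.
  rewrite /Rpower ln_exp.
  have -> : ((INR m + (lnn (N_count f m) / lam - INR m)) * lam = lnn (N_count f m))%Re.
    by field; lra.
  by rewrite exp_ln //; apply: INR_gt0.
have -> : (lnn (N_count f m) / lam - INR m =
           (lnn (N_count f m) - lam * INR m) / lam)%Re by field; lra.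
rewrite Rabs_mult (Rabs_pos_eq (/ lam)); last by apply/Rlt_le/Rinv_0_lt_compat; lra.
apply: (Rmult_le_reg_r lam); first lra.
rewrite Rmult_assoc Rinv_l ?Rmult_1_r; last lra.
apply: Rle_trans bound _.
have em0 : (0 < eps * INR m)%Re by apply: Rmult_lt_0_compat.
by have := Rmult_le_compat_l _ _ _ (Rlt_le _ _ em0) lam_ge; lra.
Qed.
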